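(* Let $\mathfrak{F}$ be a formation (of finite groups). Then: (1) $\mathfrak{F}$ contains every finite group $G$ all of whose maximal subgroups are $\tilde{\mathrm{F}}(G)$-$K$-$\mathfrak{F}$-subnormal if and only if $\mathfrak{F}$ is saturated and contains the class $\mathfrak{N}$ of all finite nilpotent groups. (2) $\mathfrak{F}$ contains every finite group $G$ all of whose maximal subgroups are $\mathrm{F}^*(G)$-$K$-$\mathfrak{F}$-subnormal if and only if $\mathfrak{F}$ is the class of all finite groups.
   Context: All groups are finite. A formation is a class of groups (closed under isomorphism) closed under taking epimorphic images and subdirect products. A formation $\mathfrak{F}$ is saturated if $G\in\mathfrak{F}$ whenever $G/\Phi(G)\in\mathfrak{F}$, where $\Phi(G)$ is the Frattini subgroup. For a formation $\mathfrak{F}$, a subgroup $H$ of $G$ is $K$-$\mathfrak{F}$-subnormal in $G$ if there is a chain $H=H_0\subseteq H_1\subseteq\dots\subseteq H_n=G$ of subgroups such that for each $i=1,\dots,n$ either $H_{i-1}\trianglelefteq H_i$ or $H_i/\mathrm{Core}_{H_i}(H_{i-1})\in\mathfrak{F}$. For a subgroup $R$ of $G$, a subgroup $H$ of $G$ is called $R$-$K$-$\mathfrak{F}$-subnormal if $H$ is $K$-$\mathfrak{F}$-subnormal in $\langle H,R\rangle$. $\mathrm{F}(G)$ is the Fitting subgroup (largest normal nilpotent subgroup) and $\mathrm{Soc}$ denotes the socle. The generalized Fitting subgroup $\mathrm{F}^*(G)$ is the subgroup containing $\mathrm{F}(G)$ with $\mathrm{F}^*(G)/\mathrm{F}(G)=\mathrm{Soc}(\mathrm{F}(G)C_G(\mathrm{F}(G))/\mathrm{F}(G))$.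 The subgroup $\tilde{\mathrm{F}}(G)$ is defined by $\Phi(G)\subseteq\tilde{\mathrm{F}}(G)$ and $\tilde{\mathrm{F}}(G)/\Phi(G)=\mathrm{Soc}(G/\Phi(G))$. *)

(* Defs.v *)
From mathcomp Require Import all_boot all_fingroup all_solvable.

Set Implicit Arguments.
Unset Strict Implicit.
Unset Printing Implicit Defensive.

Local Open Scope group_scope.

(* A finite group is a {group gT} over some finGroupType gT, so a class of
   finite groups is a predicate over all such pairs. *)
Definition group_class := forall gT : finGroupType, {group gT} -> Prop.

(* Two factors suffice in formation_subdirect: subdirect products of longer
   nonempty finite families are iterated binary ones. The empty class is thus
   a formation. *)
Record formation (F : group_class) : Prop := {
  formation_isog : forall (gT rT : finGroupType) (G : {group gT})
    (H : {group rT}), G \isog H -> F gT G -> F rT H;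
  formation_epi : forall (gT rT : finGroupType) (G : {group gT})
    (f : {morphism G >-> rT}), F gT G -> F rT (f @* G)%G;
  formation_subdirect : forall (gT1 gT2 : finGroupType) (A : {group gT1})
    (B : {group gT2}) (H : {group gT1 * gT2}),
    [set x.1 | x in H] = A -> [set x.2 | x in H] = B ->
    F gT1 A -> F gT2 B -> F _ H
}.

Definition saturated (F : group_class) : Prop :=
  forall (gT : finGroupType) (G : {group gT}),
    F _ (G / 'Phi(G))%G -> F gT G.

(* gcore H L, for H \subset L, is the core of H in L. *)
Definition K_subnormal (F : group_class) (gT : finGroupType)
    (H G : {group gT}) : Prop :=
  exists (n : nat) (C : nat -> {group gT}),
    [/\ C 0 = H, C n = G &
        forall i, i < n ->
          C i \subset C i.+1 /\
          (C i <| C i.+1 \/ F _ (C i.+1 / gcore (C i) (C i.+1))%G)].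

Definition R_K_subnormal (F : group_class) (gT : finGroupType)
    (R H : {group gT}) : Prop :=
  K_subnormal F H (H <*> R)%G.

(* minnormal N G alone does not require N \subset G. *)
Definition socle (gT : finGroupType) (G : {group gT}) : {group gT} :=
  <<\bigcup_(N : {group gT} | minnormal N G && (N \subset G)) N>>%G.

(* 'F(G) <*> 'C_G('F(G)) is the product 'F(G) * 'C_G('F(G)), as 'F(G) is
   normal in G. The preimage under the coset map contains its kernel 'F(G). *)
Definition gen_Fitting (gT : finGroupType) (G : {group gT}) : {group gT} :=
  (coset 'F(G) @*^-1 socle (('F(G) <*> 'C_G('F(G))) / 'F(G)))%G.

Definition tilde_Fitting (gT : finGroupType) (G : {group gT}) : {group gT} :=
  (coset 'Phi(G) @*^-1 socle (G / 'Phi(G)))%G.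

Definition contains_groups_with_subnormal_maximals (F : group_class)
    (R : forall gT : finGroupType, {group gT} -> {group gT}) : Prop :=
  forall (gT : finGroupType) (G : {group gT}),
    (forall M : {group gT}, maximal M G -> R_K_subnormal F (R gT G) M) ->
    F gT G.

(* Main.v *)
(* For sufficiency in (1), the intersection D of the cores of the maximal
   subgroups not containing tilde_Fitting G satisfies G / D in F, and
   D / 'Phi(G) = 1, since a minimal normal subgroup N / 'Phi(G) inside it would
   lie in the socle and yet in every maximal subgroup not containing the socle.

   For (2) it suffices to exhibit every G as a quotient of some H with
   F^*(H) <= 'Phi(H): all maximal subgroups of H then contain F^*(H). Let
   T <= SL_3(Z/25) be minimal with T A = SL_3(Z/25), where A is the kernel of
   reduction mod 5, and let P = T :&: A, so that P <= 'Phi(T). An element of T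
   congruent to 1 + E_ij mod 5 has fifth power 1 + 5 E_ij, so P contains all
   these matrices. Elements centralizing them are scalar mod 5, hence trivial
   mod 5 as the cube map is injective on units mod 5; thus 'C_T(P) <= P, and
   similarly 'F(T) = P. The wreath product H of T with G then has
   'F(H) = P^G <= 'Phi(H) and 'C_H('F(H)) <= 'F(H), so F^*(H) = 'F(H). *)
From HB Require Import structures.
Require Import Defs.
From mathcomp Require Import all_boot all_fingroup all_solvable all_algebra.

Set Implicit Arguments.
Unset Strict Implicit.
Unset Printing Implicit Defensive.

Local Open Scope group_scope.

(** * Formations and maximal subgroups *)

Section Formations.

Variables (F : group_class) (hF : formation F).

Lemma formation_homg (gT rT : finGroupType) (G : {group gT}) (H : {group rT}) :
  H \homg G -> F G -> F H.
Proof.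
case/homgP=> f fG FG; have -> : H = (f @* G)%G by apply: group_inj.
exact: formation_epi.
Qed.

Lemma formation_quotientS (gT : finGroupType) (G M N : {group gT}) :
  M <| G -> N <| G -> M \subset N -> F (G / M)%G -> F (G / N)%G.
Proof.
move=> nMG nNG sMN; apply: formation_homg.
exact: homg_quotientS (normal_norm nMG) (normal_norm nNG) sMN.
Qed.

Section PairMorphism.

Variables (aT rT1 rT2 : finGroupType) (D : {group aT}).
Variables (f : {morphism D >-> rT1}) (g : {morphism D >-> rT2}).

Definition pair_morphism x := (f x, g x).

Lemma pair_morphismM : {in D &, {morph pair_morphism : x y / x * y}}.
Proof. by move=> x y Dx Dy; rewrite /pair_morphism !morphM. Qed.

Canonical pair_morphism_morphism := Morphism pair_morphismM.

Lemma ker_pair_morphism : 'ker pair_morphism = 'ker f :&: 'ker g.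
Proof.
apply/setP=> x; rewrite !inE /=; case: (x \in D) => //=.
Qed.

End PairMorphism.

(** The two coset maps together send [G] onto a subdirect product of [G / M] and [G / N], with
    kernel [M :&: N]. *)
Lemma formation_quotientI (gT : finGroupType) (G M N : {group gT}) :
  M <| G -> N <| G -> F (G / M)%G -> F (G / N)%G -> F (G / (M :&: N))%G.
Proof.
move=> nMG nNG FM FN.
have [nM nN] := (normal_norm nMG, normal_norm nNG).
pose f := pair_morphism_morphism (restrm_morphism nM (coset_morphism M))
            (restrm_morphism nN (coset_morphism N)).
have imf1 : [set x.1 | x in f @* G] = (G / M)%G.
  apply/setP=> y; apply/imsetP/idP=> [[_ /morphimP[x _ Gx ->] ->]|].
    by rewrite /= mem_quotient.
  case/morphimP=> x _ Gx ->; exists (f x) => //; exact: mem_morphim.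
have imf2 : [set x.2 | x in f @* G] = (G / N)%G.
  apply/setP=> y; apply/imsetP/idP=> [[_ /morphimP[x _ Gx ->] ->]|].
    by rewrite /= mem_quotient.
  case/morphimP=> x _ Gx ->; exists (f x) => //; exact: mem_morphim.
apply: formation_homg (formation_subdirect hF imf1 imf2 FM FN).
have kerf : 'ker f = M :&: N.
  rewrite ker_pair_morphism !ker_restrm !ker_coset setIACA setIid.
  by apply/setIidPr; rewrite subIset ?normal_sub.
by rewrite isog_hom //= -kerf first_isog.
Qed.

(** Iterated intersection. The hypothesis on [G / G] serves the empty family, where [D] is [G]: an
    empty class is also a formation. *)
Lemma formation_quotient_bigI (gT : finGroupType) (G : {group gT})
    (s : seq {group gT}) :
    F (G / G)%G -> {in s, forall N : {group gT}, N <| G /\ F (G / N)%G} ->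
  exists D : {group gT},
    [/\ D <| G, F (G / D)%G & {in s, forall N : {group gT}, D \subset N}].
Proof.
move=> FGG; elim: s => [|N s IHs] Fs.
  by exists G; split=> //; exact: normal_refl.
have [|D [nDG FD sDs]] := IHs; first by move=> M sM; apply: Fs; rewrite inE sM orbT.
have [nNG FN] := Fs N (mem_head _ _).
exists (N :&: D)%G; split; first exact: normalI.
  exact: formation_quotientI.
move=> M; rewrite inE => /predU1P[-> | /sDs]; first exact: subsetIl.
exact/subset_trans/subsetIr.
Qed.

Lemma K_subnormal_refl (gT : finGroupType) (H : {group gT}) : K_subnormal F H H.
Proof. by exists 0, (fun _ => H). Qed.

Lemma normal_K_subnormal (gT : finGroupType) (H G : {group gT}) :
  H <| G -> K_subnormal F H G.
Proof.
move=> nHG; exists 1%N, (fun i => if i is 0 then H else G); split=> // -[] // _.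
by split; [exact: normal_sub | left].
Qed.

Lemma core_K_subnormal (gT : finGroupType) (H G : {group gT}) :
  H \subset G -> F (G / gcore H G)%G -> K_subnormal F H G.
Proof.
move=> sHG FHG; exists 1%N, (fun i => if i is 0 then H else G); split=> // -[] // _.
by split; [| right].
Qed.

Lemma maximal_K_subnormal (gT : finGroupType) (M G : {group gT}) :
  maximal M G -> K_subnormal F M G -> M <| G \/ F (G / gcore M G)%G.
Proof.
move=> maxM [n [C [C0 Cn chC]]].
have [prMG maxMG] := maxgroupP maxM.
(* Take the first index [m] with [C m] different from [M]. It is positive as [C 0] is [M], and by
   maximality [C m], properly above [M], is [G]. The link ending at [m] is then the required
   alternative. *)
have [m CmM minm] : {m | C m != M & forall i, C i != M -> m <= i}.
  have exm: exists m, C m != M.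
    exists n; rewrite Cn; apply: contraTneq prMG => ->; exact: negbT (properxx _).
  by case: (ex_minnP exm) => m; exists m.
have lemn : m <= n.
  apply: minm; rewrite Cn; apply: contraTneq prMG => ->; exact: negbT (properxx _).
case: m => [|m] in CmM minm lemn *; first by rewrite C0 eqxx in CmM.
have CmE : C m = M by apply/eqP; apply: contraT => /minm; rewrite ltnn.
have CG i : i <= n -> C i \subset G.
  move=> lein; rewrite -Cn -(subnKC lein).
  have: i + (n - i) <= n by rewrite subnKC.
  elim: (n - i) => [|k IHk]; first by rewrite addn0.
  rewrite addnS => lt_n; apply: subset_trans (IHk (ltnW lt_n)) _.
  by case: (chC _ lt_n).
have [sMC] := chC m lemn; rewrite CmE in sMC *.
suffices -> : C m.+1 = G by [].
apply: group_inj; apply/eqP; rewrite eqEproper CG //=.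
by apply: contra CmM => prC; apply/eqP/group_inj/maxMG.
Qed.

(** Any [x] of [G] outside [M] generates [G] together with [M], so [G / M] is cyclic. *)
Lemma maximal_normal_quotient_nil (gT : finGroupType) (M G : {group gT}) :
  maximal M G -> M <| G -> nilpotent (G / M).
Proof.
move=> maxM nMG; have [prMG maxMG] := maxgroupP maxM.
have [sMG [x Gx notMx]] := properP prMG.
have nMx := subsetP (normal_norm nMG) x Gx.
have sxG : <[x]> <*> M \subset G by rewrite join_subG cycle_subG Gx.
have <- : <[x]> <*> M = G.
  apply/eqP; rewrite eqEproper sxG; apply: contra notMx => prx.
  by rewrite -(maxMG _ prx (joing_subr _ _)) (subsetP (joing_subl _ _)) ?cycle_id.
by rewrite quotientYidr ?cycle_subG // quotient_cycle // abelian_nil ?cycle_abelian.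
Qed.

End Formations.

(** * Maximal subgroups, the Frattini subgroup and saturation *)

Lemma Frattini_exists_maximal (gT : finGroupType) (G X : {group gT}) :
  X \subset G -> ~~ (X \subset 'Phi(G)) ->
  exists2 M : {group gT}, maximal M G & ~~ (X \subset M).
Proof.
move=> sXG notPhi.
have [/forallP allM|] := boolP [forall M : {group gT}, maximal_eq M G ==> (X \subset M)].
  case/negP: notPhi; apply/bigcapsP=> M; exact/implyP.
rewrite negb_forall => /existsP[M]; rewrite negb_imply => /andP[/predU1P[-> | maxM] nsXM].
  by rewrite sXG in nsXM.
by exists M.
Qed.

Lemma gcore_max_sub (gT : finGroupType) (M G N : {group gT}) :
  N <| G -> N \subset M -> N \subset gcore M G.
Proof. by move=> nNG sNM; apply: gcore_max => //; exact: normal_norm. Qed.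

Lemma maximal_joing (gT : finGroupType) (G M R : {group gT}) :
  maximal M G -> R \subset G -> ~~ (R \subset M) -> (M <*> R)%G = G.
Proof.
case/maxgroupP=> prMG maxMG sRG nsRM; apply/group_inj/eqP.
rewrite eqEproper join_subG (proper_sub prMG) sRG /=.
by apply: contra nsRM => prJ; rewrite -(maxMG _ prJ) (joing_subl, joing_subr).
Qed.

Lemma tilde_Fitting_minnormal (gT : finGroupType) (G : {group gT})
    (N : {group coset_of 'Phi(G)}) :
  minnormal N (G / 'Phi(G)) -> N \subset G / 'Phi(G) ->
  coset 'Phi(G) @*^-1 N \subset tilde_Fitting G.
Proof.
move=> minN sNG; rewrite morphpreS // /socle /=.
apply: subset_trans (subset_gen _).
by apply: (bigcup_max N) => //; apply/andP.
Qed.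

Lemma tilde_Fitting_sub (gT : finGroupType) (G : {group gT}) :
  tilde_Fitting G \subset G.
Proof.
rewrite /= sub_cosetpre_quo ?Phi_normal // gen_subG.
by apply/bigcupsP=> N /andP[].
Qed.

Lemma saturated_contains_tilde_Fitting (F : group_class) :
    formation F -> saturated F ->
    (forall (gT : finGroupType) (G : {group gT}), nilpotent G -> F _ G) ->
  contains_groups_with_subnormal_maximals F (@tilde_Fitting).
Proof.
move=> hF satF nilF gT G subM; apply: satF.
pose bad (M : {group gT}) := maximal M G && ~~ (tilde_Fitting G \subset M).
(* Here [M] and [tilde_Fitting G] generate [G]. If [M] is normal in [G], it is its own core and
   [G / M] is nilpotent, hence in [F]. *)
have quoM (M : {group gT}) : maximal M G -> ~~ (tilde_Fitting G \subset M) ->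
    F _ (G / gcore M G)%G.
  move=> maxM nsTM; have := subM M maxM; rewrite /R_K_subnormal.
  rewrite (maximal_joing maxM) ?tilde_Fitting_sub //.
  case/(maximal_K_subnormal maxM) => // nMG.
  have -> : gcore M G = M.
    apply/eqP; rewrite eqEsubset gcore_sub /=; exact: gcore_max_sub.
  exact/nilF/maximal_normal_quotient_nil.
have FGG : F _ (G / G)%G by apply/nilF; rewrite /= trivg_quotient nilpotent1.
have [|D [nDG FD sDs]] := @formation_quotient_bigI F hF _ G
    [seq gcore_group M G | M <- enum (mem bad)] FGG.
  move=> _ /mapP[M + ->]; rewrite mem_enum => /andP[maxM nsM]; split; last exact: quoM.
  exact/gcore_normal/proper_sub/(maxgroupp maxM).
suffices sDPhi : D \subset 'Phi(G).
  by apply: formation_quotientS FD => //; apply: Phi_normal.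
apply: contraT => nsDPhi.
have nPhiG := normal_norm (Phi_normal G).
have nPhiD := subset_trans (normal_sub nDG) nPhiG.
have [||N minN sND] := @minnormal_exists _ (G / 'Phi(G)) (D / 'Phi(G)).
- by rewrite -subG1 quotient_sub1.
- exact: quotient_norms (normal_norm nDG).
have sNG : N \subset G / 'Phi(G) := subset_trans sND (quotientS _ (normal_sub nDG)).
have [/andP[ntN _] _] := mingroupP minN.
(* The preimage of the nontrivial [N] is not inside 'Phi(G), so some maximal [M] omits it. As the
   preimage lies in [tilde_Fitting G], this [M] is bad, so [D], and with it the preimage of [N],
   lies in [M]: a contradiction. *)
have [||M maxM nsNM] := @Frattini_exists_maximal _ G (coset 'Phi(G) @*^-1 N).
- by rewrite sub_cosetpre_quo ?Phi_normal.
- apply: contra ntN => sN.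
  by rewrite -subG1 -(cosetpreK N) -(trivg_quotient 'Phi(G)) quotientS.
have badM : bad M.
  apply/andP; split=> //; apply: contra nsNM.
  exact/subset_trans/tilde_Fitting_minnormal.
case/negP: nsNM; have sDM : D \subset M.
  apply: subset_trans (gcore_sub M G); apply: (sDs (gcore_group M G)).
  by apply/mapP; exists M; rewrite ?mem_enum.
rewrite -(quotientSGK _ (Phi_sub_max maxM)) ?cosetpreK; last exact: subsetIl.
exact: subset_trans sND (quotientS _ sDM).
Qed.

Lemma nilpotent_maximal_normal (gT : finGroupType) (M G : {group gT}) :
  nilpotent G -> maximal M G -> M <| G.
Proof.
move=> nilG maxM; have [prMG maxMG] := maxgroupP maxM.
have prN := nilpotent_proper_norm nilG prMG.
rewrite /normal proper_sub //=; apply: contraT => nsGN.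
have prNG : 'N_G(M) \proper G by rewrite properE subsetIl subsetI subxx.
by have:= prN; rewrite (maxMG _ prNG (proper_sub prN)) properxx.
Qed.

Lemma contains_nilpotent (F : group_class)
    (R : forall gT : finGroupType, {group gT} -> {group gT}) :
    (forall (gT : finGroupType) (G : {group gT}), R gT G \subset G) ->
  contains_groups_with_subnormal_maximals F R ->
  forall (gT : finGroupType) (G : {group gT}), nilpotent G -> F _ G.
Proof.
move=> sRG cF gT G nilG; apply: cF => M maxM; apply: normal_K_subnormal.
have sMG := proper_sub (maxgroupp maxM).
apply: normalS (nilpotent_maximal_normal  nilG maxM); first exact: joing_subl.
by rewrite join_subG sMG sRG.
Qed.

(** For maximal [M], the join with [R gT G] is either [M] or [G]. In the second case the core of [M]
    contains 'Phi(G), so the quotient by it is an image of [G / 'Phi(G)]. *)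
Lemma contains_saturated (F : group_class)
    (R : forall gT : finGroupType, {group gT} -> {group gT}) :
    formation F ->
    (forall (gT : finGroupType) (G : {group gT}), R gT G \subset G) ->
  contains_groups_with_subnormal_maximals F R -> saturated F.
Proof.
move=> hF sRG cF gT G FGPhi; apply: cF => M maxM; rewrite /R_K_subnormal.
have prMG := maxgroupp maxM.
have [sRM | nsRM] := boolP (R gT G \subset M).
  have -> : (M <*> R gT G)%G = M by apply: group_inj; exact/joing_idPl.
  exact: K_subnormal_refl.
rewrite (maximal_joing maxM) ?sRG //.
apply: core_K_subnormal; first exact: proper_sub.
apply: (formation_quotientS hF (Phi_normal G) _ _ FGPhi).
  exact/gcore_normal/proper_sub.
exact: gcore_max_sub (Phi_normal G) (Phi_sub_max maxM).
Qed.

(** If a maximal subgroup [M] of [T] omitted [T :&: A], then [M (T :&: A) = T], so [M A] would cover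
    [S] as well, against the minimality of [T]. *)
Lemma Frattini_supplement (gT : finGroupType) (S A T : {group gT}) :
    T \subset 'N(A) -> mingroup T [pred H : {group gT} | S \subset H * A] ->
  T :&: A \subset 'Phi(T).
Proof.
move=> nAT /mingroupP[/= sST minT].
apply/bigcapsP=> M /predU1P[-> | maxM]; first exact: subsetIl.
apply: contraT => nsM; have [prMT maxMT] := maxgroupP maxM.
have nIT : T \subset 'N(T :&: A) by rewrite normsI // normG.
have MI : (M * (T :&: A) = T)%g.
  rewrite -norm_joinEl ?(subset_trans (proper_sub prMT)) //.
  apply/eqP; rewrite eqEproper join_subG (proper_sub prMT) subsetIl /=.
  by apply: contra nsM => prJ; rewrite -(maxMT _ prJ) (joing_subl, joing_subr).
suffices MT : M = T by rewrite -MT properxx in prMT.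
apply/group_inj/(minT M) => /=; last exact: proper_sub.
apply: subset_trans sST _; rewrite -{1}MI -mulgA mulgS //.
by rewrite mulSGid // subsetIr.
Qed.

(** * Wreath products *)

Section WreathType.

Variables gT kT : finGroupType.

(* The base is indexed by all of gT, which a subgroup G of gT permutes
   semiregularly by right translation. *)
Definition wreath : Type := ({ffun gT -> kT} * gT)%type.
HB.instance Definition _ := Finite.on wreath.

Implicit Types w z : wreath.

Definition wreath_mul w z : wreath :=
  ([ffun x => w.1 x * z.1 (x * w.2)], w.2 * z.2).
Definition wreath_one : wreath := ([ffun=> 1], 1).
Definition wreath_inv w : wreath := ([ffun x => (w.1 (x * w.2^-1))^-1], w.2^-1).

Fact wreath_mulA : associative wreath_mul.
Proof.
move=> u v w; congr (_, _); last exact: mulgA.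
by apply/ffunP=> x; do 4 rewrite ?ffunE /=; rewrite !mulgA.
Qed.

Fact wreath_mul1 : left_id wreath_one wreath_mul.
Proof.
case=> f g; congr (_, _); last exact: mul1g.
by apply/ffunP=> x; rewrite !ffunE /= mulg1 mul1g.
Qed.

Fact wreath_mulV : left_inverse wreath_one wreath_inv wreath_mul.
Proof.
move=> w; congr (_, _); last exact: mulVg.
by apply/ffunP=> x; rewrite !ffunE /= mulVg.
Qed.

HB.instance Definition _ :=
  Finite_isGroup.Build wreath wreath_mulA wreath_mul1 wreath_mulV.

Lemma wreathM1 w z x : (w * z).1 x = w.1 x * z.1 (x * w.2).
Proof. by rewrite ffunE. Qed.

Lemma wreathM2 w z : (w * z).2 = w.2 * z.2. Proof. by []. Qed.

Lemma wreathV1 w x : w^-1.1 x = (w.1 (x * w.2^-1))^-1.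
Proof. by rewrite ffunE. Qed.

Lemma wreathV2 w : w^-1.2 = w.2^-1. Proof. by []. Qed.

Lemma wreath11 x : (1 : wreath).1 x = 1. Proof. by rewrite ffunE. Qed.

Lemma wreathP w z : w.2 = z.2 -> (forall x, w.1 x = z.1 x) -> w = z.
Proof. by case: w z => [f g] [f' g'] /= -> /ffunP->. Qed.

Definition wreath_inj x k : wreath := ([ffun y => if y == x then k else 1], 1).

Lemma wreath_injE x k y : (wreath_inj x k).1 y = if y == x then k else 1.
Proof. by rewrite ffunE. Qed.

Lemma wreath_injM x : {morph wreath_inj x : k l / k * l}.
Proof.
move=> k l; apply: wreathP => [|y]; first by rewrite wreathM2 mulg1.
by rewrite wreathM1 !wreath_injE mulg1; case: eqP => // _; rewrite mulg1.
Qed.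

Canonical wreath_inj_morphism x :=
  @Morphism _ _ setT (wreath_inj x) (in2W (@wreath_injM x)).

Lemma wreath_base_prod w :
  w.2 = 1 -> w = \prod_(x <- enum gT) wreath_inj x (w.1 x).
Proof.
move=> w2.
(* Generalized to duplicate-free lists for the induction: the partial product agrees with [w] on the
   listed coordinates and is trivial elsewhere. *)
have prodE s : uniq s -> let p := \prod_(x <- s) wreath_inj x (w.1 x) in
    p.2 = 1 /\ forall y, p.1 y = if y \in s then w.1 y else 1.
  elim: s => [_ | x s IHs /andP[notx /IHs[p2 p1]]] /=.
    by rewrite big_nil; split=> // y; rewrite wreath11.
  rewrite big_cons; split=> [|y]; first by rewrite wreathM2 p2 mulg1.
  rewrite wreathM1 wreath_injE mulg1 p1 inE; case: eqP => [-> | _] /=.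
    by rewrite (negPf notx) mulg1.
  by rewrite mul1g.
have [p2 p1] := prodE _ (enum_uniq gT).
by apply: wreathP => [|y]; rewrite ?p2 // p1 mem_enum.
Qed.

End WreathType.

(** If a maximal [M] omits 'Phi(N), then ['Phi(N) M = G], and the modular law gives
    [N = 'Phi(N) (N :&: M)]. Elements of 'Phi(N) are non-generators, so [N] lies in [M], a
    contradiction. *)
Lemma Frattini_normalS (gT : finGroupType) (N G : {group gT}) :
  N <| G -> 'Phi(N) \subset 'Phi(G).
Proof.
move=> nNG; apply: contraT => nsPhi.
have sPhiG := subset_trans (Phi_sub N) (normal_sub nNG).
have [M maxM nsM] := Frattini_exists_maximal sPhiG nsPhi.
have nPhiG : 'Phi(N) <| G := gFnormal_trans _ nNG.
have [sMG nPhiM] : M \subset G /\ M \subset 'N('Phi(N)).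
  have sMG := proper_sub (maxgroupp maxM); split=> //.
  exact: subset_trans sMG (normal_norm nPhiG).
have := maximal_joing maxM sPhiG nsM.
move/(congr1 (@gval _)); rewrite /= joingC (norm_joinEr nPhiM) => PhiM.
have NM : 'Phi(N) <*> (N :&: M) = N.
  rewrite norm_joinEr; last by rewrite subIset ?nPhiM ?orbT.
  by rewrite /= setIC group_modl ?Phi_sub // PhiM; apply/setIidPr/normal_sub.
have := Phi_nongen NM; rewrite genGid => /setIidPl sNM.
by rewrite (subset_trans (Phi_sub N) sNM) in nsM.
Qed.

Lemma Fitting_normalS (gT : finGroupType) (N G : {group gT}) :
  N <| G -> 'F(N) \subset 'F(G).
Proof. by move=> nNG; apply: Fitting_max (gFnormal_trans _ nNG) (Fitting_nil N). Qed.

(** * Fitting and Frattini subgroups of a wreath product *)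

Section WreathGroup.

Variables (gT kT : finGroupType) (G : {group gT}) (K : {group kT}).

Definition wreath_product : {set wreath gT kT} :=
  [set w : wreath gT kT | (w.2 \in G) && [forall x, w.1 x \in K]].

Lemma wreath_productP (w : wreath gT kT) :
  reflect (w.2 \in G /\ forall x, w.1 x \in K) (w \in wreath_product).
Proof. by rewrite inE; apply: (iffP andP) => -[Gw /forallP]. Qed.

Lemma wreath_product_group_set : group_set wreath_product.
Proof.
apply/group_setP; split=> [|w z /wreath_productP[Gw Kw] /wreath_productP[Gz Kz]].
  by apply/wreath_productP; split=> [|x]; rewrite ?wreath11 ?group1.
by apply/wreath_productP; split=> [|x]; rewrite ?wreathM1 groupM.
Qed.
Canonical wreath_product_group := Group wreath_product_group_set.

Lemma snd_wreathM :
  {in wreath_product &, {morph (snd : wreath gT kT -> gT) : w z / w * z}}.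
Proof. by []. Qed.
Canonical snd_wreath_morphism := Morphism snd_wreathM.

Lemma morphim_snd_wreath : snd_wreath_morphism @* wreath_product = G.
Proof.
apply/setP=> g; apply/morphimP/idP=> [[w _ /wreath_productP[Gw _] ->] // | Gg].
have Hg : ([ffun=> 1], g) \in wreath_product.
  by apply/wreath_productP; split=> // x; rewrite ffunE.
by exists ([ffun=> 1], g).
Qed.

Definition wreath_base := ('ker snd_wreath_morphism)%G.

Lemma wreath_baseP (w : wreath gT kT) :
  reflect (w.2 = 1 /\ forall x, w.1 x \in K) (w \in wreath_base).
Proof.
apply: (iffP idP) => [|[w2 Kw]].
  by case/morphpreP=> /wreath_productP[_ Kw] /set1P.
apply/morphpreP; split; last exact/set1P.
by apply/wreath_productP; rewrite w2.
Qed.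

(** Only on the base is evaluation multiplicative: elsewhere [w.2] shifts the argument of [z.1]. *)
Lemma eval_wreathM x :
  {in wreath_base &, {morph (fun w : wreath gT kT => w.1 x) : w z / w * z}}.
Proof. by move=> w z /wreath_baseP[w2 _] _; rewrite wreathM1 w2 mulg1. Qed.
Canonical eval_wreath_morphism x := Morphism (@eval_wreathM x).

Lemma wreath_inj_base x k : k \in K -> wreath_inj x k \in wreath_base.
Proof.
by move=> Kk; apply/wreath_baseP; split=> // y; rewrite wreath_injE; case: ifP.
Qed.

Lemma morphim_eval_wreath x : eval_wreath_morphism x @* wreath_base = K.
Proof.
apply/setP=> k; apply/morphimP/idP=> [[w _ /wreath_baseP[_ Kw] ->] | Kk].
  exact: Kw.
by exists (wreath_inj x k); rewrite ?wreath_inj_base //= wreath_injE eqxx.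
Qed.

Lemma wreath_base_normal : wreath_base <| wreath_product.
Proof. exact: ker_normal. Qed.

Lemma wreath_factor_normal x : wreath_inj x @* K <| wreath_base.
Proof.
apply/andP; split.
  by apply/subsetP=> _ /morphimP[k _ Kk ->]; apply: wreath_inj_base.
apply/subsetP=> w /wreath_baseP[w2 Kw]; rewrite inE.
apply/subsetP=> _ /imsetP[_ /morphimP[k _ Kk ->] ->].
apply/morphimP; exists (k ^ w.1 x); rewrite ?groupJ //=.
apply: wreathP => [|y]; first by rewrite conjgE !wreathM2 wreathV2 w2 invg1 !mulg1.
rewrite conjgE !wreathM1 wreathV1 wreathV2 w2 invg1 /= !mulg1 !wreath_injE.
by case: eqP => [-> | _]; rewrite ?mul1g ?mulVg // conjgE.
Qed.

Lemma sub_wreath_product (V : {group kT}) (X : {group wreath gT kT}) :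
    (forall x, wreath_inj x @* V \subset X) ->
  forall w : wreath gT kT, w.2 = 1 -> (forall x, w.1 x \in V) -> w \in X.
Proof.
move=> sVX w w2 Vw; rewrite (wreath_base_prod w2).
by apply: group_prod => x _; rewrite (subsetP (sVX x)) ?mem_morphim ?inE.
Qed.

Hypothesis prF : 'F(K) \proper K.
Hypothesis cFF : 'C_K('F(K)) \subset 'F(K).

Let H := wreath_product.

(** Each coordinate copy of [K] is normal in the base, which is normal in [H]; Fitting subgroups
    grow along both inclusions. *)
Lemma wreath_Fitting_sub x : wreath_inj x @* 'F(K) \subset 'F(H).
Proof.
apply: subset_trans (morphimF _ _ (subsetT _)) _.
apply: subset_trans (Fitting_normalS (wreath_factor_normal x)) _.
exact: Fitting_normalS wreath_base_normal.
Qed.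

Lemma wreath_Phi_sub x : 'F(K) \subset 'Phi(K) -> wreath_inj x @* 'F(K) \subset 'Phi(H).
Proof.
move=> sFPhi; apply: subset_trans (morphimS _ sFPhi) _.
apply: subset_trans (morphimF _ _ (subsetT _)) _.
apply: subset_trans (Frattini_normalS (wreath_factor_normal x)) _.
exact: Frattini_normalS wreath_base_normal.
Qed.

Lemma wreath_cent_Fitting (w : wreath gT kT) :
  w \in 'C_H('F(H)) -> w.2 = 1 /\ forall x, w.1 x \in 'F(K).
Proof.
case/setIP=> /wreath_productP[_ Kw] /centP cw.
have cVw x v y : v \in 'F(K) ->
    w.1 y * (if y * w.2 == x then v else 1) = (if y == x then v else 1) * w.1 y.
  move=> Vv; have Fv : wreath_inj x v \in 'F(H).
    apply: (subsetP (wreath_Fitting_sub x)).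
    by rewrite mem_morphim ?(subsetP (Fitting_sub K)).
  have : (w * wreath_inj x v).1 y = (wreath_inj x v * w).1 y by rewrite cw.
  by rewrite !wreathM1 !wreath_injE mulg1.
(* If [w.2] moves the coordinate 1, comparing values there gives [v = 1] for all [v] in 'F(K). Then
   [K] centralizes 'F(K), so [K] lies in 'F(K), against [prF]. *)
have w2 : w.2 = 1.
  apply: contraTeq prF => w2; rewrite properE negb_and negbK; apply/orP; right.
  apply: subset_trans cFF; rewrite subsetI subxx centsC; apply/subsetP=> v Vv.
  rewrite (_ : v = 1) ?group1 //.
  have := cVw 1 v 1 Vv; rewrite mul1g (negPf w2) eqxx mulg1.
  by rewrite -{1}[w.1 1]mul1g => /mulIg.
split=> // x; apply: (subsetP cFF); rewrite inE Kw; apply/centP=> v Vv.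
by have := cVw x v x Vv; rewrite w2 mulg1 eqxx.
Qed.

Lemma wreath_Fitting w : w \in 'F(H) -> w.2 = 1 /\ forall x, w.1 x \in 'F(K).
Proof.
(* Evaluation at [x] maps the nilpotent normal subgroup ['F(H) :&: wreath_base] of the base onto a
   nilpotent normal subgroup of [K]. *)
have evF : forall z : wreath gT kT, z \in 'F(H) :&: wreath_base ->
    forall x, z.1 x \in 'F(K).
  move=> z Fz x; have nFB : 'F(H) :&: wreath_base <| wreath_base.
    rewrite /normal subsetIr normsI ?normG //.
    exact: subset_trans (normal_sub wreath_base_normal) (normal_norm (Fitting_normal _)).
  have : eval_wreath_morphism x @* ('F(H) :&: wreath_base) \subset 'F(K).
    apply: Fitting_max.
      by rewrite -[X in _ <| X](morphim_eval_wreath x) morphim_normal.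
    exact/morphim_nil/(nilpotentS (subsetIl _ _))/Fitting_nil.
  move/subsetP; apply; apply: (mem_morphim (eval_wreath_morphism x)) => //.
  by case/setIP: Fz.
move=> Fw; have w2 : w.2 = 1; last first.
  split=> // x; apply: evF; rewrite inE Fw; apply/wreath_baseP; split=> //.
  by have /wreath_productP[] := subsetP (Fitting_sub _) w Fw.
(* If [w.2] is nontrivial, then for any [k] in [K] the commutator of [w] with the copy of [k] at
   coordinate 1 lies in 'F(H) and in the base, and has value [k] at 1. So [K] lies in 'F(K). *)
apply: contraTeq prF => w2; rewrite properE negb_and negbK; apply/orP; right.
apply/subsetP=> k Kk; pose b : wreath gT kT := wreath_inj 1 k.
have Bb : b \in wreath_base by apply: wreath_inj_base.
have Hb := subsetP (normal_sub wreath_base_normal) b Bb.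
have Hw := subsetP (Fitting_sub _) w Fw.
have Fwb : [~ w, b] \in 'F(H).
  by rewrite groupM ?groupV // memJ_norm // (subsetP (normal_norm (Fitting_normal _))).
have Bwb : [~ w, b] \in wreath_base.
  rewrite -[wreath_base]/('ker _)%G commgEr groupM // memJ_norm ?groupV //.
  exact: (subsetP (normal_norm wreath_base_normal)).
have := evF _ (introT setIP (conj Fwb Bwb)) 1.
have b2 : b.2 = 1 by [].
have -> : [~ w, b].1 1 = k; last by [].
rewrite commgEl conjgE !wreathM1 !wreathV1 wreathV2 b2 invg1 mul1g !mulg1.
rewrite !wreath_injE wreathV2 invg_eq1 (negPf w2) b2 invg1 mul1g.
by rewrite !invg1 !mulg1 mulVg eqxx mulKg.
Qed.

Lemma wreath_Fitting_Phi :
  'F(K) \subset 'Phi(K) -> 'F(H) \subset 'Phi(H).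
Proof.
move=> sFPhi; apply/subsetP=> w /wreath_Fitting[w2 Fw].
by apply: (@sub_wreath_product 'F(K) 'Phi(H)) w2 Fw => x; apply: wreath_Phi_sub.
Qed.

Lemma wreath_cent_Fitting_sub : 'C_H('F(H)) \subset 'F(H).
Proof.
apply/subsetP=> w /wreath_cent_Fitting[w2 Fw].
by apply: (@sub_wreath_product 'F(K) 'F(H)) w2 Fw => x; apply: wreath_Fitting_sub.
Qed.

End WreathGroup.

(** The socle is then taken in the trivial group, where it is trivial since minimal normal subgroups
    are not. *)
Lemma gen_Fitting_cent_sub (gT : finGroupType) (G : {group gT}) :
  'C_G('F(G)) \subset 'F(G) -> gen_Fitting G = 'F(G) :> {set gT}.
Proof.
move/joing_idPl=> FC; rewrite /= FC trivg_quotient.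
have -> : socle 1 = 1 :> {set coset_of 'F(G)}.
  by apply/trivgP; rewrite gen_subG; apply/bigcupsP=> N /andP[].
by rewrite -kerE ker_coset.
Qed.

(** * A congruence subgroup of SL_3(Z/25) *)

Section CongruenceSubgroup.

Import GRing.Theory.
Local Open Scope ring_scope.

(** Reduces a decidable property on Z/25 to a computation over 25 numerals. *)
Lemma Z25_ind (P : pred 'Z_25) :
  all (fun m => P m%:R) (iota 0 25) -> forall x, P x.
Proof.
move=> /allP allP x; rewrite -[x]natr_Zp; apply: allP.
by rewrite mem_iota ltn_ord.
Qed.

Lemma Z25_ann5 (x : 'Z_25) : 5 * x = 0 -> exists y, x = 5 * y.
Proof.
move/eqP=> x5; exists (inZp (x %/ 5)); apply/eqP; move: x5; apply/implyP.
by move: x; apply: Z25_ind; vm_compute.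
Qed.

(* [x = 5 y] with [y] a unit, of inverse [y ^+ 19]. *)
Lemma Z25_ann5_inv (x : 'Z_25) : 5 * x = 0 -> x != 0 -> exists y, y * x = 5.
Proof.
move/eqP=> x5 x0; exists (inZp (x %/ 5) ^+ 19); apply/eqP.
move: x5; apply/implyP; move: x0; apply/implyP.
by move: x; apply: Z25_ind; vm_compute.
Qed.

(** Equality after multiplication by 5 is congruence mod 5. The units mod 5 form a group of order 4,
    prime to 3, so cubing is injective on them. *)
Lemma Z25_cube (x : 'Z_25) : 5 * x ^+ 3 = 5 -> 5 * x = 5.
Proof.
move/eqP=> x5; apply/eqP; move: x5; apply/implyP.
by move: x; apply: Z25_ind; vm_compute.
Qed.

(** As [x] is a multiple of 5, the cube is [1 + 3 x], and 3 is a unit. *)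
Lemma Z25_unipotent_cube (x : 'Z_25) : 5 * x = 0 -> (1 + x) ^+ 3 = 1 -> x = 0.
Proof.
move=> /eqP x5 /eqP x1; apply/eqP; move: x1; apply/implyP; move: x5; apply/implyP.
by move: x; apply: Z25_ind; vm_compute.
Qed.

Section Annihilator.

Variable R : comNzRingType.

(** Equality after scaling by [c] is congruence modulo the annihilator of [c], which determinants,
    being polynomial in the entries, respect. *)
Lemma scale_det (c : R) n (A B : 'M[R]_n) :
  c *: A = c *: B -> c * \det A = c * \det B.
Proof.
move=> cAB; rewrite /determinant !mulr_sumr; apply: eq_bigr => s _.
rewrite !mulrA ![c * _]mulrC -!mulrA; congr (_ * _).
elim/big_rec2: _ => // i a b _ IH.
have := congr1 (fun M : 'M_n => M i (s i)) cAB; rewrite !mxE => ci.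
by rewrite !mulrA ci mulrAC IH mulrAC.
Qed.

Lemma mulmx_deltaE m n p (A : 'M[R]_(m, n)) i (j : 'I_p) k l :
  (A *m delta_mx i j) k l = A k i * (l == j)%:R.
Proof.
rewrite mxE (bigD1 i) //= big1 ?addr0 => [|h /negPf ne]; last first.
  by rewrite mxE ne mulr0.
by rewrite mxE eqxx.
Qed.

Lemma mul_delta_mxE m n p (i : 'I_p) j (A : 'M[R]_(m, n)) k l :
  (delta_mx i j *m A) k l = (k == i)%:R * A j l.
Proof.
rewrite mxE (bigD1 j) //= big1 ?addr0 => [|h /negPf ne]; last first.
  by rewrite mxE ne andbF mul0r.
by rewrite mxE eqxx andbT.
Qed.

Lemma scale_comm_delta (c : R) n (A : 'M[R]_n.+1) :
    (forall i j, i != j -> c *: (A * delta_mx i j) = c *: (delta_mx i j * A)) ->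
  c *: A = (c * A 0 0)%:M.
Proof.
move=> cA.
have eqA i j k l : i != j ->
    c * (A k i * (l == j)%:R) = c * ((k == i)%:R * A j l).
  move=> /cA/matrixP/(_ k l).
  by rewrite [LHS]mxE mulmx_deltaE [RHS]mxE mul_delta_mxE.
(* Off the diagonal, use entry [(i, i)] of the relation for [delta_mx j i]; on it, entry [(i, 0)] of
   the relation for [delta_mx i 0]. *)
apply/matrixP=> i j; rewrite !mxE; have [<- | ne] := eqVneq i j; last first.
  have:= eqA j i i i; rewrite eq_sym => /(_ ne).
  by rewrite eqxx mulr1 (negPf ne) mul0r mulr0 mulr0n.
have [-> // | ne] := eqVneq i 0.
by have:= eqA i 0 i 0 ne; rewrite !eqxx mul1r !mulr1.
Qed.

End Annihilator.

(** With [M = N + Y], the binomial formula applies to [1 + M]. Here [M ^+ 4 = 0], and the terms in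
    [M ^+ 2] and [M ^+ 3] have coefficient 10 and are killed by 5, so only [1 + M *+ 5 = 1 + N *+ 5]
    is left. *)
Lemma expr5_lift (S : nzRingType) (N Y : S) :
    N * N = 0 -> (forall Z, Y * Z * Y = 0) -> Y *+ 5 = 0 ->
  (1 + N + Y) ^+ 5 = 1 + N *+ 5.
Proof.
move=> NN YY Y5; rewrite -addrA; set M := N + Y.
have YYo : Y * Y = 0 by rewrite -{1}[Y]mulr1 YY.
have M2 : M * M = N * Y + Y * N by rewrite /M mulrDl !mulrDr NN YYo add0r addr0.
have M4 : M ^+ 4 = 0.
  rewrite (exprM M 2 2) [M ^+ 2]M2 expr2 mulrDl !mulrDr.
  rewrite -[Y * N * (Y * N)]mulrA !mulrA YY -[N * Y * Y]mulrA YYo -[Y * N * N]mulrA NN.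
  rewrite -[N * Y * N * Y]mulrA -[N * Y * (N * Y)]mulrA [Y * (N * Y)]mulrA.
  by rewrite YY !mulr0 !mul0r !addr0.
have M5 : M *+ 5 = N *+ 5 by rewrite mulrnDl Y5 addr0.
have M25 : M ^+ 2 *+ 5 = 0.
  by rewrite expr2 -mulrnAr M5 mulrnAr /M mulrDl NN add0r -mulrnAl Y5 mul0r.
have M35 : M ^+ 3 *+ 5 = 0 by rewrite exprS -mulrnAr M25 mulr0.
rewrite exprDn_comm; last exact: commr_sym (commr1 _).
rewrite !big_ord_recl big_ord0 /= /bump /=.
rewrite !expr1n !mul1r !addr0 expr1 expr0.
change (1 + (M *+ 5 + (M ^+ 2 *+ (5 * 2) + (M ^+ 3 *+ (5 * 2)
  + (M ^+ 4 *+ 5 + M * M ^+ 4)))) = 1 + N *+ 5).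
by rewrite !(mulrnA _ 5) M25 M35 M4 M5 mulr0 !mul0rn !addr0.
Qed.

(** * Matrix spaces stable under conjugation by transvections *)

Section Commutant.

(** [C] will be commutation with a normal subgroup. The inverse of [1 + delta_mx i j] is
    [1 - delta_mx i j], so [CJ] is stability under conjugation. *)
Variables (n : nat) (C : 'M['Z_25]_n.+1 -> Prop).
Hypothesis CB : forall Y Z, C Y -> C Z -> C (Y - Z).
Hypothesis CZ : forall a Y, C Y -> C (a *: Y).
Hypothesis CJ : forall i j Y, i != j -> 5 *: Y = 0 -> C Y ->
  C ((1 - delta_mx i j) * Y * (1 + delta_mx i j)).

Let commd i j Y : i != j -> 5 *: Y = 0 -> C Y ->
  C (Y * delta_mx i j - delta_mx i j * Y - delta_mx i j * Y * delta_mx i j).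
Proof.
move=> ne Y5 CY; have := CB (CJ ne Y5 CY) CY.
rewrite mulrDr mulr1 !mulrBl mul1r; congr C.
by rewrite addrC !addrA addNr add0r [- _ + Y * _]addrC.
Qed.

Let delta_sandwich i j (Y : 'M['Z_25]_n.+1) :
  delta_mx i j * Y * delta_mx i j = Y j i *: delta_mx i j.
Proof.
apply/matrixP=> k l; rewrite mulmx_deltaE mul_delta_mxE !mxE.
by rewrite mulrAC -natrM mulnb mulrC.
Qed.

Let CN0 (a : 'Z_25) i j : 5 * a = 0 -> a != 0 -> C (a *: delta_mx i j) ->
  C (5 *: delta_mx i j).
Proof.
by move=> a5 /(Z25_ann5_inv a5)[y <-]; rewrite -scalerA; apply: CZ.
Qed.

(** Write [E] for [delta_mx i j]. Since [E * E = 0], applying [commd] twice leaves [- 2 E Y E], that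
    is [- 2 Y j i] times [E], and this coefficient can be scaled to 5. *)
Let C_offdiag i j Y : i != j -> 5 *: Y = 0 -> C Y -> Y j i != 0 ->
  C (5 *: delta_mx i j).
Proof.
move=> ne Y5 CY Yji.
have dd : delta_mx i j * delta_mx i j = 0 :> 'M['Z_25]_n.+1.
  by apply: mul_delta_mx_0; rewrite eq_sym.
have a5 : 5 * Y j i = 0 by have /matrixP/(_ j i) := Y5; rewrite !mxE.
apply: (@CN0 (- (Y j i *+ 2))).
- by rewrite mulrN mulrnAr a5 mul0rn oppr0.
- apply: contraNneq Yji => Y2.
  (* As [a = 5 a - 4 a] and [5 a = 0], vanishing of [2 a] would force [a = 0]. *)
  have -> : Y j i = 5 * Y j i + (- (Y j i *+ 2)) *+ 2.
    by rewrite mulr_natl mulNrn -mulrnA -mulrnBr.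
  by rewrite a5 Y2 mul0rn addr0.
set Z := Y * delta_mx i j - delta_mx i j * Y - delta_mx i j * Y * delta_mx i j.
have Z5 : 5 *: Z = 0.
  have EY5 : 5 *: (delta_mx i j * Y) = 0 by rewrite scalerAr Y5 mulr0.
  by rewrite /Z !scalerBr EY5 2!scalerAl EY5 Y5 !mul0r !subr0.
have := commd ne Z5 (commd ne Y5 CY); rewrite -/Z; congr C.
have ZE : Z * delta_mx i j = - (delta_mx i j * Y * delta_mx i j).
  by rewrite /Z !mulrBl -!mulrA dd !mulr0 sub0r subr0.
have EZ : delta_mx i j * Z = delta_mx i j * Y * delta_mx i j.
  by rewrite /Z !mulrBr !mulrA dd !mul0r !subr0.
rewrite -[delta_mx i j * Z * _]mulrA ZE EZ mulrN !mulrA dd !mul0r oppr0 subr0.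
by rewrite -opprD delta_sandwich -mulr2n scaleNr scalerMnl.
Qed.

(** [commd] with [delta_mx j k] turns [delta_mx i j] into the Lie bracket of the two, which is
    [delta_mx i k]. *)
Let C_step i j k : i != j -> k != i -> C (5 *: delta_mx i j) -> C (5 *: delta_mx i k).
Proof.
move=> ij ki Cij; have [<- // | jk] := eqVneq j k.
have Y5 : 5 *: (5 *: delta_mx i j) = 0 :> 'M['Z_25]_n.+1.
  by rewrite scalerA (_ : 5 * 5 = 0) ?scale0r //; apply/eqP.
have EE : delta_mx i j * delta_mx j k = delta_mx i k :> 'M['Z_25]_n.+1.
  exact: mul_delta_mx.
have EE0 : delta_mx j k * delta_mx i j = 0 :> 'M['Z_25]_n.+1.
  exact: mul_delta_mx_0.
have := commd jk Y5 Cij; congr C.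
by rewrite -scalerAr -scalerAl EE EE0 scaler0 mul0r !subr0.
Qed.

Let C_sym i j : i != j -> C (5 *: delta_mx i j) -> C (5 *: delta_mx j i).
Proof.
move=> ij Cij; apply: (C_offdiag _ _ Cij); rewrite 1?eq_sym //.
  by rewrite scalerA (_ : 5 * 5 = 0) ?scale0r //; apply/eqP.
by rewrite !mxE !eqxx.
Qed.

(** For [b] other than [i], pass through the positions [(i, j)], [(i, b)], [(b, i)], [(b, a)],
    [(a, b)]. *)
Let C_all i j a b : i != j -> C (5 *: delta_mx i j) -> a != b -> C (5 *: delta_mx a b).
Proof.
move=> ij Cij ab; have [bi | bi] := eqVneq b i.
  by rewrite bi in ab *; apply: C_sym (C_step ij ab Cij); rewrite eq_sym.
have Cib := C_step ij bi Cij.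
have ib : i != b by rewrite eq_sym.
by apply: C_sym (C_step bi ab (C_sym ib Cib)); rewrite eq_sym.
Qed.

Lemma commutant_full Y : 5 *: Y = 0 -> C Y -> ~~ is_scalar_mx Y ->
  forall i j, i != j -> C (5 *: delta_mx i j).
Proof.
move=> Y5 CY notY i j ne.
have [/existsP[a /existsP[b /andP[ab Yab]]] | ] :=
    boolP [exists a, exists b, (a != b) && (Y a b != 0)].
  have ba : b != a by rewrite eq_sym.
  exact: (C_all ba (C_offdiag ba Y5 CY Yab) ne).
move/existsPn=> offY.
have {}offY a b : a != b -> Y a b = 0.
  by move=> ab; have /existsPn/(_ b) := offY a; rewrite ab negbK => /eqP.
(* For diagonal [Y], [commd] with [delta_mx a 0] gives [(Y a a - Y 0 0) *: delta_mx a 0]. If all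
   these differences vanish, [Y] is scalar. *)
have [/existsP[a Yaa] | /existsPn diagY] := boolP [exists a, Y a a != Y 0 0].
  have a0 : a != 0 by apply: contraNneq Yaa => ->.
  apply: (@C_all a 0) ne => //; apply: (@CN0 (Y a a - Y 0 0)).
  - have /matrixP Y5' := Y5; rewrite mulrBr.
    by have:= Y5' a a; have:= Y5' 0 0; rewrite !mxE => -> ->; rewrite subr0.
  - by rewrite subr_eq0.
  have := commd a0 Y5 CY; rewrite delta_sandwich (offY 0 a) 1?eq_sym // scale0r subr0.
  congr C; apply/matrixP=> k l.
  have mxB (A B : 'M['Z_25]_n.+1) : (A - B) k l = A k l - B k l by rewrite !mxE.
  rewrite mxB mulmx_deltaE mul_delta_mxE !mxE.
  have [-> | ka] := eqVneq k a; have [-> | l0] := eqVneq l 0.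
  - by rewrite !mulr1 mul1r.
  - by rewrite !mulr0 mul1r offY 1?eq_sym // subr0.
  - by rewrite !mulr0 mulr1 mul0r offY // subr0.
  - by rewrite !mulr0 mul0r subr0.
case/negP: notY; apply/is_scalar_mxP; exists (Y 0 0).
apply/matrixP=> k l; rewrite mxE; have [<- | kl] := eqVneq k l; last exact: offY.
by apply/eqP; have:= diagY k; rewrite negbK.
Qed.

End Commutant.

(** * SL_3(Z/25) and the kernel of reduction mod 5 *)

Local Notation GL3 := {'GL_3['Z_25]}.

Lemma mul_ann5 n (Y Z : 'M['Z_25]_n.+1) : 5 *: Y = 0 -> 5 *: Z = 0 -> Y * Z = 0.
Proof.
move=> /matrixP Y5 /matrixP Z5; apply/matrixP=> i j; rewrite !mxE big1 // => k _.
have := Y5 i k; rewrite !mxE => /Z25_ann5[y ->].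
by rewrite mulrAC; have := Z5 k j; rewrite !mxE => ->; rewrite mul0r.
Qed.

Lemma det_transvection (R : comNzRingType) n (i j : 'I_n.+1) (a : R) :
  i != j -> \det (1 + a *: delta_mx i j : 'M_n.+1) = 1.
Proof.
wlog ltij : i j / (j < i)%N.
  move=> IH ne; have [lt_ij | lt_ji | /val_inj eq_ij] := ltngtP i j; last first.
  - by rewrite eq_ij eqxx in ne.
  - exact: IH.
  - rewrite -det_tr linearD /= linearZ /= trmx_delta.
    by rewrite -[1]/(1%:M) tr_scalar_mx; apply: IH; rewrite 1?eq_sym.
move=> ne; rewrite det_trig; last first.
  apply/is_trig_mxP=> k l lt_kl; rewrite !mxE -[k == l]val_eqE ltn_eqF //=.
  have [ki | _] /= := eqVneq k i; last by rewrite mulr0 addr0.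
  have [lj | _] /= := eqVneq l j; last by rewrite mulr0 addr0.
  by rewrite ki lj ltnNge ltnW in lt_kl.
apply: big1 => k _; rewrite !mxE eqxx; have [-> | ] /= := eqVneq k i.
  by rewrite (negPf ne) mulr0 addr0.
by rewrite mulr0 addr0.
Qed.

Definition SL3 : {set GL3} := [set g : GL3 | \det (GLval g) == 1].
(** Congruence to 1 mod 5, written without a reduction map. *)
Definition congruence_ker : {set GL3} := [set g : GL3 | 5 *: GLval g == 5 *: 1].

Lemma SL3_group_set : group_set SL3.
Proof.
apply/group_setP; split=> [|x y]; rewrite !inE ?det1 //.
by rewrite det_mulmx => /eqP-> /eqP->; rewrite mulr1.
Qed.
Canonical SL3_group := Group SL3_group_set.

Lemma congruence_ker_group_set : group_set congruence_ker.
Proof.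
apply/group_setP; split=> [|x y]; rewrite !inE ?eqxx // => /eqP x5 /eqP y5.
by rewrite GL_ME scalerAl x5 -scalerAl mul1r y5.
Qed.
Canonical congruence_ker_group := Group congruence_ker_group_set.

Lemma congruence_kerP (g : GL3) :
  reflect (5 *: GLval g = 5 *: 1) (g \in congruence_ker).
Proof. by rewrite inE; apply: eqP. Qed.

Lemma congruence_ker_norm (G : {set GL3}) : G \subset 'N(congruence_ker).
Proof.
apply/subsetP=> x _; apply/normP; apply/eqP.
rewrite eqEcard cardJg leqnn andbT; apply/subsetP=> _ /imsetP[g /congruence_kerP g5 ->].
apply/congruence_kerP; rewrite conjgE !GL_ME scalerAr scalerAl g5.
by rewrite -scalerAl mul1r -scalerAr -GL_ME mulVg.
Qed.

Lemma congruence_ker_abelian : abelian congruence_ker.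
Proof.
apply/centsP=> x /congruence_kerP x5 y /congruence_kerP y5.
(* Writing [u = 1 + a] and [v = 1 + b] with [a], [b] killed by 5, the product [a b] vanishes. *)
have prodE (u v : 'M['Z_25]_3) : 5 *: u = 5 *: 1 -> 5 *: v = 5 *: 1 ->
    u * v = u + v - 1.
  move=> u5 v5; rewrite -{1}(subrK 1 u) -{1}(subrK 1 v) mulrDl mulrDr mul1r mulr1.
  by rewrite mul_ann5 ?scalerBr ?u5 ?v5 ?subrr // add0r subrK addrAC.
by apply: val_inj; rewrite /= !prodE // [X in X - 1]addrC.
Qed.

Lemma transvection_exists (i j : 'I_3) : i != j ->
  exists2 u : GL3, u \in SL3 & GLval u = 1 + delta_mx i j.
Proof.
move=> ne; have det1 : \det (1 + delta_mx i j : 'M['Z_25]_3) = 1.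
  by have := det_transvection (1 : 'Z_25) ne; rewrite scale1r.
have unitu : (1 + delta_mx i j : 'M['Z_25]_3) \is a GRing.unit.
  by rewrite -[_ \is a _]/(_ \in unitmx) unitmxE det1 unitr1.
by exists (FinRing.Unit unitu); rewrite // inE /= det1.
Qed.

(** Such a [g] is scalar mod 5, and determinant 1 makes the cube of that scalar 1 mod 5, so the
    scalar itself is 1 mod 5. *)
Lemma SL3_scalar_mod5 (g : GL3) : g \in SL3 ->
    (forall i j, i != j ->
      GLval g * (5 *: delta_mx i j) = (5 *: delta_mx i j) * GLval g) ->
  g \in congruence_ker.
Proof.
rewrite inE => /eqP detg cg; apply/congruence_kerP.
have g5 : 5 *: GLval g = 5 *: (GLval g 0 0)%:M.
  rewrite scale_scalar_mx; apply: scale_comm_delta => i j /cg.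
  by rewrite -scalerAr -scalerAl.
have := scale_det g5; rewrite detg det_scalar mulr1 => /esym/Z25_cube cu.
by rewrite g5 scale_scalar_mx cu -scalemx1.
Qed.

(** * The Fitting subgroup of a supplement to the congruence kernel *)

Section Supplement.

Variable T : {group GL3}.
Hypothesis sTSL : T \subset SL3.
Hypothesis sSLT : SL3 \subset (T * congruence_ker)%g.

Lemma transvection_lift (i j : 'I_3) : i != j ->
  exists2 t, t \in T & exists2 Y, GLval t = 1 + delta_mx i j + Y & 5 *: Y = 0.
Proof.
case/transvection_exists=> u SLu Eu.
have /mulsgP[t a Tt Aa def_u] := subsetP sSLT u SLu.
exists t => //; exists (GLval t - GLval u); first by rewrite -Eu addrC subrK.
rewrite def_u GL_ME scalerBr scalerAr.
by have /congruence_kerP-> := Aa; rewrite -scalerAr mulr1 subrr.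
Qed.

Lemma elementary_in_T (i j : 'I_3) : i != j ->
  exists2 x, x \in T :&: congruence_ker & GLval x = 1 + 5 *: delta_mx i j.
Proof.
move=> ne; have [t Tt [Y Et Y5]] := transvection_lift ne.
have Ex : GLval (t ^+ 5)%g = 1 + 5 *: delta_mx i j.
  have -> : GLval (t ^+ 5)%g = GLval t ^+ 5.
    by rewrite !expgS expg0 !exprS expr0.
  rewrite Et expr5_lift ?scaler_nat //.
  - by apply: mul_delta_mx_0; rewrite eq_sym.
  - by move=> Z; apply: mul_ann5; rewrite ?scalerAl ?Y5 ?mul0r.
  - by rewrite -scaler_nat.
exists (t ^+ 5)%g => //; rewrite inE groupX //=; apply/congruence_kerP.
rewrite Ex scalerDr scalerA (_ : 5 * 5 = 0) ?scale0r ?addr0 //; exact/eqP.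
Qed.

Let P := (T :&: congruence_ker)%G.

Lemma cent_congruence_sub : 'C_T(P) \subset congruence_ker.
Proof.
apply/subsetP=> g /setIP[Tg /centP cPg]; apply: SL3_scalar_mod5 => [|i j ne].
  exact: (subsetP sTSL).
have [x Px Ex] := elementary_in_T ne.
have := congr1 (@GLval _ _) (cPg x Px); rewrite !GL_ME Ex.
by rewrite mulrDr mulrDl mulr1 mul1r => /addrI.
Qed.

(** The transvection may lie outside [T], but some [t] in [T] is congruent to it mod 5, and on a [Y]
    killed by 5 both act alike by conjugation. As [t] normalizes [Q], it preserves the commutant of
    [Q]. *)
Lemma transvection_conj (Q : {group GL3}) (i j : 'I_3) (Y : 'M['Z_25]_3) :
    T \subset 'N(Q) -> i != j -> 5 *: Y = 0 ->
    (forall q, q \in Q -> GLval q * Y = Y * GLval q) ->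
  forall q, q \in Q ->
    GLval q * ((1 - delta_mx i j) * Y * (1 + delta_mx i j)) =
    ((1 - delta_mx i j) * Y * (1 + delta_mx i j)) * GLval q.
Proof.
move=> nQT ne Y5 cY q Qq; have [t Tt [Z Et Z5]] := transvection_lift ne.
have tV : GLval t * GLval t^-1%g = 1 by rewrite -GL_ME mulgV.
have Vt : GLval t^-1%g * GLval t = 1 by rewrite -GL_ME mulVg.
have dd : delta_mx i j * delta_mx i j = 0 :> 'M['Z_25]_3.
  by apply: mul_delta_mx_0; rewrite eq_sym.
set u := 1 + delta_mx i j; set v := 1 - delta_mx i j.
have vu : v * u = 1 by rewrite /v /u mulrBl mul1r mulrDr mulr1 dd addr0 addrK.
have vt : v = GLval t^-1%g + v * Z * GLval t^-1%g.
  have vt1 : v * GLval t = 1 + v * Z by rewrite Et -/u mulrDr vu.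
  by rewrite -[LHS]mulr1 -tV mulrA vt1 mulrDl mul1r.
have Yu : Y * u = Y * GLval t by rewrite Et -/u [RHS]mulrDr (mul_ann5 Y5 Z5) addr0.
have -> : v * Y * u = GLval t^-1%g * Y * GLval t.
  have ZY : Z * (GLval t^-1%g * Y) = 0.
    by apply: mul_ann5; rewrite // scalerAr Y5 mulr0.
  rewrite -mulrA Yu {1}vt mulrDl mulrA.
  have -> : v * Z * GLval t^-1%g * (Y * GLval t)
          = v * (Z * (GLval t^-1%g * Y)) * GLval t by rewrite !mulrA.
  by rewrite ZY mulr0 mul0r addr0.
have Qqt : (q ^ t^-1)%g \in Q by rewrite memJ_norm // groupV (subsetP nQT).
have qE : GLval q * GLval t^-1%g = GLval t^-1%g * GLval (q ^ t^-1)%g.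
  by rewrite -!GL_ME -conjgC.
have qE' : GLval (q ^ t^-1)%g * GLval t = GLval t * GLval q.
  by rewrite -!GL_ME conjgE invgK -!mulgA mulVg mulg1.
move: (cY _ Qqt) qE qE'; move: (GLval (q ^ t^-1)%g) => q' cq' qE qE'.
rewrite -[RHS]mulrA -qE' !mulrA qE; congr (_ * _).
by rewrite -!mulrA cq'.
Qed.

(** The centre of the nilpotent [Q] meets [P] in some [d] other than 1. Then [d - 1] commutes with
    [Q], is killed by 5, and is not scalar, since a scalar [d] of determinant 1 congruent to 1 mod 5
    is 1. By [commutant_full], [Q] centralizes every [5 *: delta_mx i j], hence is trivial mod 5. *)
Lemma normal_nilpotent_sub_congruence (Q : {group GL3}) :
  Q <| T -> nilpotent Q -> P \subset Q -> Q \subset congruence_ker.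
Proof.
move=> nQT nilQ sPQ.
have nPT : P <| T by rewrite /normal subsetIl normsI ?normG ?congruence_ker_norm.
have ne01 : 0 != 1 :> 'I_3 by [].
have ntP : P :!=: 1%g.
  apply/trivgPn; have [x Px Ex] := elementary_in_T ne01; exists x => //.
  apply: contra_eq_neq Ex => ->; rewrite GL_1E -subr_eq0 opprD addrA subrr sub0r oppr_eq0.
  by apply/eqP=> /matrixP/(_ 0 1); rewrite !mxE.
have := meet_center_nil nilQ (normalS sPQ (normal_sub nQT) nPT) ntP.
case/trivgPn=> d /setIP[/setIP[Td /congruence_kerP d5] /centerP[Qd cd]] nt_d.
pose C (Y : 'M['Z_25]_3) := forall q, q \in Q -> GLval q * Y = Y * GLval q.
have C5 : forall i j, i != j -> C (5 *: delta_mx i j).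
  apply: (@commutant_full _ C _ _ _ (GLval d - 1)).
  - by move=> Y Z cY cZ q Qq; rewrite mulrBr mulrBl cY ?cZ.
  - by move=> a Y cY q Qq; rewrite -scalerAr -scalerAl cY.
  - move=> i j Y ne Y5 cY; exact: transvection_conj (normal_norm nQT) ne Y5 cY.
  - by rewrite scalerBr d5 subrr.
  - move=> q Qq; have := congr1 (@GLval _ _) (cd q Qq).
    by rewrite !GL_ME mulrBr mulrBl mulr1 mul1r => ->.
  apply: contra nt_d => /is_scalar_mxP[a Ea].
  have d_a : GLval d = (1 + a)%:M by rewrite -[LHS](subrK 1) Ea addrC raddfD.
  have a5 : 5 * a = 0.
    have := congr1 (fun M : 'M_3 => (5 *: M) 0 0) Ea.
    by rewrite scalerBr d5 subrr !mxE.
  have : (1 + a) ^+ 3 = 1.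
    by rewrite -det_scalar -d_a; apply/eqP; have := subsetP sTSL d Td; rewrite inE.
  move=> a1; rewrite -val_eqE /= d_a (_ : a = 0) ?addr0 //.
  exact: Z25_unipotent_cube.
apply/subsetP=> q Qq; apply: SL3_scalar_mod5 => [|i j ne].
  exact/(subsetP sTSL)/(subsetP (normal_sub nQT)).
exact: C5.
Qed.

Lemma Fitting_supplement : 'F(T) = P.
Proof.
have nPT : P <| T by rewrite /normal subsetIl normsI ?normG ?congruence_ker_norm.
have sPF : P \subset 'F(T).
  by apply/Fitting_max/abelian_nil/(abelianS _ congruence_ker_abelian)/subsetIr.
apply/eqP; rewrite eqEsubset sPF andbT subsetI Fitting_sub /=.
exact: normal_nilpotent_sub_congruence (Fitting_normal T) (Fitting_nil T) sPF.
Qed.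

End Supplement.

Lemma exists_faithful_Frattini_Fitting :
  exists (kT : finGroupType) (K : {group kT}),
    [/\ 'F(K) \proper K, 'C_K('F(K)) \subset 'F(K) & 'F(K) \subset 'Phi(K)].
Proof.
pose supp := [pred H : {group GL3} | SL3 \subset (H * congruence_ker)%g].
have supp_SL : supp SL3_group by rewrite /= mulG_subl.
have [T minT sTSL] := mingroup_exists supp_SL.
have sSLT : SL3 \subset (T * congruence_ker)%g := mingroupp minT.
have FT := Fitting_supplement sTSL sSLT.
exists GL3, T; split; rewrite FT.
(* [T] contains a lift of a transvection, which is not 1 mod 5. *)
- rewrite properEneq subsetIl andbT; apply/eqP=> PT.
  have [t Tt [Y Et Y5]] := @transvection_lift T sSLT 0 1 isT.
  have /setIP[_ /congruence_kerP] : t \in T :&: congruence_ker by rewrite PT.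
  rewrite Et !scalerDr Y5 addr0 -[RHS]addr0 => /addrI/matrixP/(_ 0 1).
  by rewrite !mxE.
- by rewrite subsetI subsetIl cent_congruence_sub.
- exact: Frattini_supplement (congruence_ker_norm T) minT.
Qed.

End CongruenceSubgroup.

Theorem theorem1 (F : group_class) (hF : formation F) :
  (contains_groups_with_subnormal_maximals F (@tilde_Fitting) <->
     saturated F /\
     (forall (gT : finGroupType) (G : {group gT}), nilpotent G -> F gT G)) /\
  (contains_groups_with_subnormal_maximals F (@gen_Fitting) <->
     (forall (gT : finGroupType) (G : {group gT}), F gT G)).
Proof.
split; split.
- move=> cF; split; first exact: contains_saturated (@tilde_Fitting_sub) cF.
  exact: contains_nilpotent (@tilde_Fitting_sub) cF.
- case; exact: saturated_contains_tilde_Fitting.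
- move=> cF gT G; have [kT [K [prF cFF sFPhi]]] := exists_faithful_Frattini_Fitting.
  pose H := wreath_product_group G K.
  have FH : F _ H.
    apply: cF => M maxM; rewrite /R_K_subnormal.
    have -> : (M <*> gen_Fitting H)%G = M.
      apply: group_inj; apply/joing_idPl.
      rewrite (gen_Fitting_cent_sub (wreath_cent_Fitting_sub G prF cFF)).
      exact: subset_trans (wreath_Fitting_Phi G prF sFPhi) (Phi_sub_max maxM).
    exact: K_subnormal_refl.
  have -> : G = (snd_wreath_morphism G K @* H)%G.
    by apply: group_inj; rewrite /= morphim_snd_wreath.
  exact: formation_epi.
- by move=> allF gT G _.
Qed.
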